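(* A well-conditioned 1-equation system $y=G(x,y)$ has at most one characteristic point; if there is such a point it must be the extreme point $(\rho,\tau)$ of the standard solution $T(x)$.
   Context: A 1-equation system $y=G(x,y)$, with $G$ a power series in two variables, is well-conditioned if: (a) $G(x,y)$ has nonnegative real coefficients; (b) $G$ is holomorphic in a neighborhood of the origin; (c) $G(0,y)=0$; (d) $G(x,0)\neq 0$; (e) $\partial G/\partial y\ne 0$ (irreducibility); (f) $\partial^2G/\partial y^2\ne 0$. For such a system there is a unique formal power series $T(x)$ with nonnegative coefficients satisfying $T(x)=G(x,T(x))$ formally (it satisfies $T(0)=0$), called the standard solution. It is a standard fact that its radius of convergence $\rho$ lies in $(0,\infty)$ and that $\tau:=T(\rho)<\infty$; $(\rho,\tau)$ is the extreme point. A characteristic point is a point $(a,b)\in\mathbb{R}^2$ with $a,b>0$ solving the characteristic system $y=G(x,y)$, $1=\dfrac{\partial G}{\partial y}(x,y)$ (in particular the series $G$ and $\partial G/\partial y$ converge at $(a,b)$; the point is allowed to lie on the boundary of the domain of convergence of $G$). *)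

(* Defs.v *)
From Stdlib Require Import Reals Lra Lia Wf_nat.
From Coquelicot Require Import Coquelicot.
Open Scope R_scope.

(* Stdlib reals with Coquelicot.  A power series G(x,y) = sum g_ij x^i y^j is
   represented by its coefficients g i j, a series T(x) = sum t_n x^n by t n. *)

(* Absolute convergence of a double series; by Fubini-Tonelli this is
   unconditional summability of the family (u i j) over nat * nat. *)
Definition double_summable (u : nat -> nat -> R) : Prop :=
  (forall i, ex_series (fun j => Rabs (u i j))) /\
  ex_series (fun i => Series (fun j => Rabs (u i j))).

Definition is_double_series (u : nat -> nat -> R) (l : R) : Prop :=
  double_summable u /\ l = Series (fun i => Series (fun j => u i j)).

Definition is_pseries2 (g : nat -> nat -> R) (x y l : R) : Prop :=
  is_double_series (fun i j => g i j * x ^ i * y ^ j) l.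

(* Weierstrass form of holomorphy for a power series: it converges absolutely
   on an open polydisc around the origin of C^2. *)
Definition holomorphic_near_origin (g : nat -> nat -> R) : Prop :=
  exists r : R, 0 < r /\
    forall x y : C, Cmod x < r -> Cmod y < r ->
      double_summable (fun i j => Cmod (RtoC (g i j) * x ^ i * y ^ j)%C).

Definition partial_y (g : nat -> nat -> R) : nat -> nat -> R :=
  fun i => PS_derive (g i).

Record well_conditioned (g : nat -> nat -> R) : Prop := {
  wc_nonneg : forall i j, 0 <= g i j;
  wc_holo : holomorphic_near_origin g;
  wc_x0 : forall j, g 0%nat j = 0;
  wc_y0 : exists i, g i 0%nat <> 0;
  wc_dy : exists i j, partial_y g i j <> 0;
  wc_dyy : exists i j, partial_y (partial_y g) i j <> 0
}.

Fixpoint PS_pow (t : nat -> R) (j : nat) : nat -> R :=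
  match j with
  | O => fun n => match n with O => 1 | S _ => 0 end
  | S j' => PS_mult t (PS_pow t j')
  end.

(* The n-th coefficient of the formal series G(x, T(x)), for T with zero
   constant term: T^j then has order at least j, so the terms with j > n
   do not contribute. *)
Definition PS_subst (g : nat -> nat -> R) (t : nat -> R) (n : nat) : R :=
  sum_f_R0 (fun i => sum_f_R0 (fun j => g i j * PS_pow t j (n - i)) n) n.

Definition standard_solution (g : nat -> nat -> R) (t : nat -> R) : Prop :=
  t 0%nat = 0 /\ (forall n, 0 <= t n) /\ (forall n, t n = PS_subst g t n).

Definition extreme_point (t : nat -> R) (rho tau : R) : Prop :=
  CV_radius t = Finite rho /\ is_pseries t rho tau.

(* Membership of (a, b) in the open domain of convergence is not required. *)
Definition characteristic_point (g : nat -> nat -> R) (a b : R) : Prop :=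
  0 < a /\ 0 < b /\ is_pseries2 g a b b /\ is_pseries2 (partial_y g) a b 1.

Lemma PS_pow_agree (s t : nat -> R) (m : nat) :
  (forall k, (k <= m)%nat -> s k = t k) ->
  forall j k, (k <= m)%nat -> PS_pow s j k = PS_pow t j k.
Proof.
intros H j; induction j as [|j IH]; intros k Hk; [reflexivity|].
simpl; unfold PS_mult; apply sum_eq; intros i Hi.
rewrite H by lia; rewrite IH by lia; reflexivity.
Qed.

Lemma PS_subst_agree (g : nat -> nat -> R) (s t : nat -> R) (n : nat) :
  (forall j, g 0%nat j = 0) ->
  (forall k, (k < n)%nat -> s k = t k) -> PS_subst g s n = PS_subst g t n.
Proof.
intros Hg H; unfold PS_subst; apply sum_eq; intros i Hi.
apply sum_eq; intros j _.
destruct i as [|i]; [rewrite Hg; ring|].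
rewrite (PS_pow_agree s t (n - S i)); [reflexivity| |lia].
intros k Hk; apply H; lia.
Qed.

Lemma PS_subst_nonneg (g : nat -> nat -> R) (t : nat -> R) (n : nat) :
  (forall i j, 0 <= g i j) -> (forall k, 0 <= t k) -> 0 <= PS_subst g t n.
Proof.
intros Hg Ht.
assert (Hp : forall j k, 0 <= PS_pow t j k).
{ induction j as [|j IH]; intros k; simpl.
  - destruct k; lra.
  - apply cond_pos_sum; intros i; apply Rmult_le_pos; auto. }
apply cond_pos_sum; intros i; apply cond_pos_sum; intros j.
apply Rmult_le_pos; auto.
Qed.

Lemma standard_solution_unique (g : nat -> nat -> R) (s t : nat -> R) :
  well_conditioned g -> standard_solution g s -> standard_solution g t ->
  forall n, s n = t n.
Proof.
intros Hg [_ [_ Hs]] [_ [_ Ht]].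
induction n as [n IH] using lt_wf_ind.
rewrite Hs, Ht; apply PS_subst_agree; [apply wc_x0; exact Hg | exact IH].
Qed.

Lemma standard_solution_exists (g : nat -> nat -> R) :
  well_conditioned g -> exists t, standard_solution g t.
Proof.
intros Hg; pose proof (wc_x0 g Hg) as Hx0; pose proof (wc_nonneg g Hg) as Hnn.
set (it := fix it k := match k with
  | O => fun _ : nat => 0 | S k' => PS_subst g (it k') end).
assert (Hpos : forall k n, 0 <= it k n).
{ induction k as [|k IH]; intros n; [simpl; lra|].
  apply PS_subst_nonneg; auto. }
assert (Hst : forall k n, (n < k)%nat -> it (S k) n = it k n).
{ induction k as [|k IH]; intros n Hn; [lia|].
  change (PS_subst g (it (S k)) n = PS_subst g (it k) n).
  apply PS_subst_agree; [exact Hx0|]; intros m Hm; apply IH; lia. }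
assert (Hdiag : forall d n, it (d + S n)%nat n = it (S n) n).
{ induction d as [|d IH]; intros n; [reflexivity|].
  rewrite <- IH; apply Hst; lia. }
exists (fun n => it (S n) n); split; [|split].
- change (PS_subst g (it 0%nat) 0 = 0); unfold PS_subst; simpl.
  rewrite Hx0; ring.
- intros n; apply Hpos.
- intros n; change (PS_subst g (it n) n = PS_subst g (fun k => it (S k) k) n).
  apply PS_subst_agree; [exact Hx0|]; intros k Hk.
  replace n with ((n - S k) + S k)%nat by lia; apply Hdiag.
Qed.

(* Main.v *)
Require Import Defs.
From Stdlib Require Import Reals Lra Lia.
From Coquelicot Require Import Coquelicot.
Open Scope R_scope.

(** Everything is read off coefficientwise from the tangent inequality
    z^j >= y^j + j y^(j-1) (z - y). If (a, b) is characteristic, then the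
    partial sums of T(a) are bounded by b = G(a, b), so T(a) converges. For
    x >= a at which T(x) = z converges, the tangent at (a, b) gives
    z = G(x, z) >= G(a, b) + G_y(a, b) (z - b) = z, so every term of the
    inequality is an equality. At x = a the quadratic term of G in y then forces
    T(a) = b, and x > a is impossible because G(., 0) has a nonzero coefficient.
    Hence (a, b) is the extreme point, which in turn determines (a, b). *)

(** * Double series as limits of sums over squares *)

(** Summing over one finite square lets several double series be combined and compared term by term
    before a single limit is taken. *)
Definition rect_sum (u : nat -> nat -> R) (M : nat) : R :=
  sum_f_R0 (fun i => sum_f_R0 (fun j => u i j) M) M.

Lemma sum_f_R0_mono (u : nat -> R) (m n : nat) :
  (forall k, 0 <= u k) -> (m <= n)%nat -> sum_f_R0 u m <= sum_f_R0 u n.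
Proof.
intros Hu Hmn; induction Hmn as [|n _ IH]; [lra|].
simpl; specialize (Hu (S n)); lra.
Qed.

Lemma sum_f_R0_stable (u : nat -> R) (m n : nat) :
  (m <= n)%nat -> (forall k, (m < k)%nat -> u k = 0) ->
  sum_f_R0 u n = sum_f_R0 u m.
Proof.
intros Hmn Hu; induction Hmn as [|n Hmn IH]; [reflexivity|].
simpl; rewrite IH, Hu by lia; ring.
Qed.

Lemma sum_f_R0_ge_term (u : nat -> R) (m n : nat) :
  (forall k, 0 <= u k) -> (m <= n)%nat -> u m <= sum_f_R0 u n.
Proof.
intros Hu Hmn.
apply Rle_trans with (sum_f_R0 u m); [|apply sum_f_R0_mono; assumption].
destruct m as [|m]; simpl; [lra|].
pose proof (cond_pos_sum u m Hu); lra.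
Qed.

Lemma is_lim_seq_sum_f_R0 (u : nat -> R) (l : R) :
  is_series u l -> is_lim_seq (sum_f_R0 u) l.
Proof.
intros H; apply is_lim_seq_ext with (sum_n u); [|exact H].
intros n; apply sum_n_Reals.
Qed.

Lemma sum_f_R0_le_series (u : nat -> R) (l : R) (n : nat) :
  (forall k, 0 <= u k) -> is_series u l -> sum_f_R0 u n <= l.
Proof.
intros Hu Hl.
apply (is_lim_seq_incr_compare _ _ (is_lim_seq_sum_f_R0 u l Hl)).
intros k; simpl; specialize (Hu (S k)); lra.
Qed.

Lemma series_le_of_sum_f_R0_le (u : nat -> R) (l B : R) :
  (forall n, sum_f_R0 u n <= B) -> is_series u l -> l <= B.
Proof.
intros HB Hl.
exact (is_lim_seq_le _ _ l B HB (is_lim_seq_sum_f_R0 u l Hl)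
  (is_lim_seq_const B)).
Qed.

Lemma ex_series_of_sum_f_R0_le (u : nat -> R) (B : R) :
  (forall k, 0 <= u k) -> (forall n, sum_f_R0 u n <= B) -> ex_series u.
Proof.
intros Hu HB.
destruct (ex_finite_lim_seq_incr (sum_f_R0 u) B) as [l Hl].
- intros n; simpl; specialize (Hu (S n)); lra.
- exact HB.
- exists l; apply is_lim_seq_ext with (2 := Hl).
  intros n; symmetry; apply sum_n_Reals.
Qed.

Lemma is_lim_seq_sum_f_R0_fixed (f : nat -> nat -> R) (r : nat -> R) (N : nat) :
  (forall i, is_lim_seq (f i) (r i)) ->
  is_lim_seq (fun M => sum_f_R0 (fun i => f i M) N) (sum_f_R0 r N).
Proof.
intros Hf; induction N as [|N IH]; [apply Hf|].
simpl; apply is_lim_seq_plus'; [exact IH | apply Hf].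
Qed.

Lemma double_series_rows (u : nat -> nat -> R) (l : R) :
  (forall i j, 0 <= u i j) -> is_double_series u l ->
  (forall i, is_series (u i) (Series (u i))) /\
  is_series (fun i => Series (u i)) l.
Proof.
intros Hu [[Hr Hs] ->].
assert (E : forall i, Series (fun j => Rabs (u i j)) = Series (u i)).
{ intros i; apply Series_ext; intros j; apply Rabs_pos_eq, Hu. }
split.
- intros i; apply Series_correct.
  apply (ex_series_ext (fun j => Rabs (u i j)));
    [intros j; apply Rabs_pos_eq, Hu | apply Hr].
- apply (Series_correct (fun i => Series (u i))).
  exact (ex_series_ext _ _ E Hs).
Qed.

Lemma rect_sum_le_double_series (u : nat -> nat -> R) (l : R) (M : nat) :
  (forall i j, 0 <= u i j) -> is_double_series u l -> rect_sum u M <= l.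
Proof.
intros Hu H; destruct (double_series_rows u l Hu H) as [Hr Hs].
assert (Hle : forall i n, sum_f_R0 (u i) n <= Series (u i)).
{ intros i n; apply sum_f_R0_le_series; [apply Hu | apply Hr]. }
apply Rle_trans with (sum_f_R0 (fun i => Series (u i)) M).
- apply sum_Rle; intros i _; apply Hle.
- apply sum_f_R0_le_series; [|exact Hs].
  intros i; apply Rle_trans with (2 := Hle i 0%nat); apply Hu.
Qed.

(** Finitely many rows come within eps/2 of [l], and finitely many columns of those rows lose at
    most another eps/2. Any square containing that rectangle lies between it and [l], by
    nonnegativity. *)
Lemma is_lim_seq_rect_sum (u : nat -> nat -> R) (l : R) :
  (forall i j, 0 <= u i j) -> is_double_series u l ->
  is_lim_seq (rect_sum u) l.
Proof.
intros Hu H; destruct (double_series_rows u l Hu H) as [Hr Hs].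
apply is_lim_seq_spec; intros eps.
pose proof (is_lim_seq_sum_f_R0 _ _ Hs) as HN.
apply is_lim_seq_spec in HN.
destruct (HN (pos_div_2 eps)) as [N HN']; specialize (HN' N (le_n N)).
assert (HM := is_lim_seq_sum_f_R0_fixed (fun i => sum_f_R0 (u i)) _ N
  (fun i => is_lim_seq_sum_f_R0 _ _ (Hr i))).
apply is_lim_seq_spec in HM.
destruct (HM (pos_div_2 eps)) as [M HM'].
exists (max N M); intros n Hn.
specialize (HM' n ltac:(lia)); simpl in HM', HN'.
apply Rabs_def2 in HM'; apply Rabs_def2 in HN'.
pose proof (rect_sum_le_double_series u l n Hu H) as Hup.
assert (Hlow : sum_f_R0 (fun i => sum_f_R0 (u i) n) N <= rect_sum u n).
{ apply (sum_f_R0_mono (fun i => sum_f_R0 (u i) n)); [|lia].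
  intros i; apply cond_pos_sum, Hu. }
apply Rabs_def1; pose proof (cond_pos eps); lra.
Qed.

(** Moves the term of G_y with y^(j-1) to column j, the column of the term of G it comes from, so
    that both series can be added over the same squares. *)
Lemma double_series_shift (u : nat -> nat -> R) (l : R) :
  is_double_series u l ->
  is_double_series
    (fun i j => match j with O => 0 | S k => u i k end) l.
Proof.
intros [[Hr Hs] ->].
assert (E : forall i,
  Series (fun j => Rabs match j with O => 0 | S k => u i k end)
  = Series (fun j => Rabs (u i j))).
{ intros i; rewrite Series_incr_1_aux; [reflexivity | apply Rabs_R0]. }
split; [split|].
- intros i; apply ex_series_incr_1; exact (Hr i).
- exact (ex_series_ext _ _ (fun i => eq_sym (E i)) Hs).
- apply Series_ext; intros i; symmetry.
  now rewrite Series_incr_1_aux.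
Qed.

Lemma rect_sum_plus (u v : nat -> nat -> R) (M : nat) :
  rect_sum (fun i j => u i j + v i j) M = rect_sum u M + rect_sum v M.
Proof.
unfold rect_sum; rewrite <- plus_sum; apply sum_eq; intros i _; apply plus_sum.
Qed.

Lemma rect_sum_scal (c : R) (u : nat -> nat -> R) (M : nat) :
  rect_sum (fun i j => c * u i j) M = c * rect_sum u M.
Proof.
unfold rect_sum; rewrite scal_sum; apply sum_eq; intros i _.
rewrite (Rmult_comm _ c), scal_sum; apply sum_eq; intros j _; ring.
Qed.

Lemma rect_sum_le (u v : nat -> nat -> R) (M : nat) :
  (forall i j, u i j <= v i j) -> rect_sum u M <= rect_sum v M.
Proof.
intros H; apply sum_Rle; intros i _; apply sum_Rle; intros j _; apply H.
Qed.

Lemma rect_sum_ge_term (u : nat -> nat -> R) (i j M : nat) :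
  (forall i j, 0 <= u i j) -> (i <= M)%nat -> (j <= M)%nat ->
  u i j <= rect_sum u M.
Proof.
intros Hu Hi Hj.
apply Rle_trans with (sum_f_R0 (u i) M);
  [apply sum_f_R0_ge_term; [apply Hu | exact Hj]|].
apply (sum_f_R0_ge_term (fun i => sum_f_R0 (u i) M)); [|exact Hi].
intros k; apply cond_pos_sum, Hu.
Qed.

(** * Tangent inequalities for powers *)

(** Multiplying the inequality for j by z exceeds the one for j + 1 by exactly j y^(j-1) (z - y)^2.
    At j = 0 the factor [INR 0] makes the value of [pred 0] harmless. *)
Lemma pow_tangent (y z : R) (j : nat) :
  0 <= y -> 0 <= z -> y ^ j + INR j * y ^ pred j * (z - y) <= z ^ j.
Proof.
intros Hy Hz; induction j as [|j IH]; [simpl; lra|].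
rewrite S_INR; simpl pred.
assert (H := Rmult_le_compat_l z _ _ Hz IH).
destruct j as [|j]; [simpl in *; lra|].
simpl pred in *; rewrite <- !tech_pow_Rmult in *.
pose proof (Rmult_le_pos _ _ (pos_INR (S j))
  (Rmult_le_pos _ _ (pow_le y j Hy) (Rle_0_sqr (z - y)))).
unfold Rsqr in *; nra.
Qed.

(** The surplus (j + 1) y^j (z - y)^2 of the last multiplication by z is now positive. Exponents 0
    and 1 are excluded because they give equality. *)
Lemma pow_tangent_strict (y z : R) (j : nat) :
  0 < y -> 0 <= z -> z <> y ->
  y ^ S (S j) + INR (S (S j)) * y ^ S j * (z - y) < z ^ S (S j).
Proof.
intros Hy Hz Hne.
assert (H := Rmult_le_compat_l z _ _ Hz
  (pow_tangent y z (S j) (Rlt_le _ _ Hy) Hz)).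
rewrite (S_INR (S j)); simpl pred in H.
rewrite <- !tech_pow_Rmult in *.
assert (0 < Rsqr (z - y)) by (apply Rsqr_pos_lt; lra).
assert (0 < INR (S j)) by (apply lt_0_INR; lia).
pose proof (Rmult_lt_0_compat _ _ H1
  (Rmult_lt_0_compat _ _ (pow_lt y j Hy) H0)).
unfold Rsqr in *; nra.
Qed.

(** * Powers of a power series and substitution into G *)

Lemma PS_pow_nonneg (t : nat -> R) :
  (forall k, 0 <= t k) -> forall j k, 0 <= PS_pow t j k.
Proof.
intros Ht; induction j as [|j IH]; intros k; simpl.
- destruct k; lra.
- apply cond_pos_sum; intros i; apply Rmult_le_pos; auto.
Qed.

Lemma PS_pow_order (t : nat -> R) :
  t 0%nat = 0 -> forall j k, (k < j)%nat -> PS_pow t j k = 0.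
Proof.
intros Ht; induction j as [|j IH]; intros k Hk; [lia|].
simpl; unfold PS_mult.
rewrite (sum_eq _ (fun _ => 0)), sum_cte; [ring|].
intros [|i] Hi; [rewrite Ht | rewrite IH by lia]; ring.
Qed.

(** Induction by Cauchy products; nonnegativity supplies the absolute convergence that they
    require. *)
Lemma is_pseries_PS_pow (t : nat -> R) (x l : R) :
  (forall k, 0 <= t k) -> 0 <= x -> is_pseries t x l ->
  forall j, is_pseries (PS_pow t j) x (l ^ j).
Proof.
intros Ht Hx Hl; apply is_pseries_R in Hl; intros j; apply is_pseries_R.
induction j as [|j IH].
- apply (is_lim_seq_ext (fun _ => 1) _ 1); [|apply is_lim_seq_const].
  intros n; rewrite sum_n_Reals, (sum_f_R0_stable _ 0 n (Nat.le_0_l n)).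
  + simpl; ring.
  + intros [|k] Hk; [lia | simpl; ring].
- assert (Habs : forall p s, (forall k, 0 <= p k) ->
    is_series (fun n => p n * x ^ n) s ->
    ex_series (fun n => Rabs (p n * x ^ n))).
  { intros p s Hp Hs; exists s.
    apply is_series_ext with (2 := Hs); intros n; symmetry.
    apply Rabs_pos_eq, Rmult_le_pos; [apply Hp | apply pow_le, Hx]. }
  refine (is_series_ext _ _ _ _ (is_series_mult _ _ _ _ Hl IH
    (Habs _ _ Ht Hl) (Habs _ _ (PS_pow_nonneg t Ht j) IH))).
  intros n; simpl; unfold PS_mult; rewrite Rmult_comm, scal_sum.
  apply sum_eq; intros k Hk.
  assert (E : x ^ n = x ^ k * x ^ (n - k)) by (rewrite <- pow_add; f_equal; lia).
  rewrite E; ring.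
Qed.

Lemma is_pseries_sum_f_R0 (p : nat -> nat -> R) (x : R) (l : nat -> R) (N : nat) :
  (forall i, is_pseries (p i) x (l i)) ->
  is_pseries (fun n => sum_f_R0 (fun i => p i n) N) x (sum_f_R0 l N).
Proof.
intros Hp; induction N as [|N IH]; [apply Hp|].
exact (is_pseries_plus _ _ _ _ _ IH (Hp (S N))).
Qed.

(** The coefficient of x^n in G_K(x, T(x)), where G_K keeps the monomials with i, j <= K and
    [PS_incr_n] encodes the factor x^i. Unlike in [PS_subst], the index range does not depend on n,
    so evaluation at x is a finite linear combination of convergent series. *)
Definition rect_subst (g : nat -> nat -> R) (t : nat -> R) (K n : nat) : R :=
  rect_sum (fun i j => g i j * PS_incr_n (PS_pow t j) i n) K.

Lemma is_pseries_rect_subst (g : nat -> nat -> R) (t : nat -> R) (x l : R) (K : nat) :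
  (forall k, 0 <= t k) -> 0 <= x -> is_pseries t x l ->
  is_pseries (rect_subst g t K) x (rect_sum (fun i j => g i j * x ^ i * l ^ j) K).
Proof.
intros Ht Hx Hl; unfold rect_subst, rect_sum.
refine (is_pseries_sum_f_R0 (fun i n => sum_f_R0 (fun j =>
  g i j * PS_incr_n (PS_pow t j) i n) K) _ _ _ _); intros i.
refine (is_pseries_sum_f_R0 (fun j n =>
  g i j * PS_incr_n (PS_pow t j) i n) _ _ _ _); intros j.
replace (g i j * x ^ i * l ^ j)
  with (scal (g i j) (scal (pow_n x i) (l ^ j) : R))
  by (rewrite pow_n_pow; unfold scal; simpl; unfold mult; simpl; ring).
apply (is_pseries_scal (g i j) (PS_incr_n (PS_pow t j) i)).
- apply Rmult_comm.
- apply (is_pseries_incr_n (PS_pow t j) i x (l ^ j)).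
  apply is_pseries_PS_pow; assumption.
Qed.

Lemma PS_incr_n_nonneg (p : nat -> R) (i n : nat) :
  (forall k, 0 <= p k) -> 0 <= PS_incr_n p i n.
Proof.
intros Hp; rewrite PS_incr_n_simplify.
destruct (Compare_dec.le_lt_dec i n); [apply Hp | apply Rle_refl].
Qed.

Lemma rect_subst_nonneg (g : nat -> nat -> R) (t : nat -> R) (K n : nat) :
  (forall i j, 0 <= g i j) -> (forall k, 0 <= t k) -> 0 <= rect_subst g t K n.
Proof.
intros Hg Ht; apply cond_pos_sum; intros i; apply cond_pos_sum; intros j.
apply Rmult_le_pos; [apply Hg | apply PS_incr_n_nonneg, PS_pow_nonneg, Ht].
Qed.

Lemma rect_subst_mono (g : nat -> nat -> R) (t : nat -> R) (K L n : nat) :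
  (forall i j, 0 <= g i j) -> (forall k, 0 <= t k) -> (K <= L)%nat ->
  rect_subst g t K n <= rect_subst g t L n.
Proof.
intros Hg Ht HKL; unfold rect_subst, rect_sum.
set (u := fun i j => g i j * PS_incr_n (PS_pow t j) i n).
assert (Hu : forall i j, 0 <= u i j).
{ intros i j; apply Rmult_le_pos;
    [apply Hg | apply PS_incr_n_nonneg, PS_pow_nonneg, Ht]. }
apply Rle_trans with (sum_f_R0 (fun i => sum_f_R0 (u i) K) L).
- apply (sum_f_R0_mono (fun i => sum_f_R0 (u i) K)); [|exact HKL].
  intros i; apply cond_pos_sum, Hu.
- apply sum_Rle; intros i _; apply sum_f_R0_mono; [apply Hu | exact HKL].
Qed.

(** Beyond the square of side n nothing contributes to x^n: the factor x^i removes i > n, and T^j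
    has order at least j. *)
Lemma rect_subst_eq (g : nat -> nat -> R) (t : nat -> R) (K n : nat) :
  t 0%nat = 0 -> (n <= K)%nat -> rect_subst g t K n = PS_subst g t n.
Proof.
intros Ht HnK; unfold rect_subst, rect_sum, PS_subst.
rewrite (sum_f_R0_stable _ n K HnK).
- apply sum_eq; intros i Hi.
  rewrite (sum_f_R0_stable _ n K HnK).
  + apply sum_eq; intros j _; rewrite PS_incr_n_simplify.
    destruct (Compare_dec.le_lt_dec i n); [reflexivity | lia].
  + intros j Hj; rewrite PS_incr_n_simplify.
    destruct (Compare_dec.le_lt_dec i n); [|lia].
    rewrite PS_pow_order by (trivial; lia); ring.
- intros i Hi; rewrite (sum_eq _ (fun _ => 0)), sum_cte; [ring|].
  intros j _; rewrite PS_incr_n_simplify.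
  destruct (Compare_dec.le_lt_dec i n); [lia|].
  apply Rmult_0_r.
Qed.

Lemma rect_subst_le (g : nat -> nat -> R) (t : nat -> R) (K n : nat) :
  (forall i j, 0 <= g i j) -> (forall k, 0 <= t k) -> t 0%nat = 0 ->
  rect_subst g t K n <= PS_subst g t n.
Proof.
intros Hg Ht Ht0; rewrite <- (rect_subst_eq g t (max K n)) by (trivial; lia).
apply rect_subst_mono; trivial; lia.
Qed.

(** * Bounds for G along the solution and against the tangent *)

(** Truncating G only lowers the coefficients of G(x, T(x)) = T(x). This is the half G(x, l) <= l of
    the fixed-point equation, in a form that does not presuppose convergence of G at (x, l). *)
Lemma rect_sum_at_solution_le (g : nat -> nat -> R) (t : nat -> R) (x l : R) (K : nat) :
  (forall i j, 0 <= g i j) -> standard_solution g t -> 0 <= x ->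
  is_pseries t x l -> rect_sum (fun i j => g i j * x ^ i * l ^ j) K <= l.
Proof.
intros Hg [Ht0 [Ht Hfix]] Hx Hl.
assert (Hs := is_pseries_rect_subst g t x l K Ht Hx Hl).
apply is_pseries_R in Hs; apply is_pseries_R in Hl.
refine (series_le_of_sum_f_R0_le _ _ _ _ Hs); intros n.
apply Rle_trans with (sum_f_R0 (fun k => t k * x ^ k) n).
- apply sum_Rle; intros k _; apply Rmult_le_compat_r; [apply pow_le, Hx|].
  rewrite Hfix; apply rect_subst_le; assumption.
- apply sum_f_R0_le_series; [|exact Hl].
  intros k; apply Rmult_le_pos; [apply Ht | apply pow_le, Hx].
Qed.

Lemma is_pseries_truncate (t : nat -> R) (x : R) (n : nat) :
  is_pseries (fun k => if Compare_dec.le_lt_dec k n then t k else 0) x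
    (sum_f_R0 (fun k => t k * x ^ k) n).
Proof.
apply is_pseries_R.
set (l := sum_f_R0 (fun k => t k * x ^ k) n).
apply (is_lim_seq_ext_loc (fun _ => l) _ l); [|apply is_lim_seq_const].
exists n; intros m Hm; rewrite sum_n_Reals, (sum_f_R0_stable _ n m Hm).
- apply sum_eq; intros k Hk.
  destruct (Compare_dec.le_lt_dec k n); [reflexivity | lia].
- intros k Hk; destruct (Compare_dec.le_lt_dec k n); [lia | ring].
Qed.

(* Applying G to the truncation of T after order n reproduces T up to
   order n + 1, and G(a, s) <= G(a, b) = b for s <= b. *)
Lemma solution_partial_sum_le (g : nat -> nat -> R) (t : nat -> R) (a b : R) :
  well_conditioned g -> standard_solution g t -> 0 <= a -> 0 <= b ->
  is_pseries2 g a b b -> forall n, sum_f_R0 (fun k => t k * a ^ k) n <= b.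
Proof.
intros Hwc [Ht0 [Ht Hfix]] Ha Hb HG.
pose proof (wc_nonneg g Hwc) as Hg.
induction n as [|n IH]; [simpl; rewrite Ht0; lra|].
set (s := fun k => if Compare_dec.le_lt_dec k n then t k else 0).
assert (Hs : forall k, 0 <= s k).
{ intros k; unfold s; destruct (Compare_dec.le_lt_dec k n); [apply Ht | lra]. }
assert (Hser := is_pseries_truncate t a n); fold s in Hser.
set (S' := sum_f_R0 (fun k => t k * a ^ k) n) in *.
assert (HS' : 0 <= S').
{ apply cond_pos_sum; intros k; apply Rmult_le_pos; [apply Ht | apply pow_le, Ha]. }
assert (Hsub := is_pseries_rect_subst g s a S' (S n) Hs Ha Hser).
apply is_pseries_R in Hsub.
apply Rle_trans with (sum_f_R0 (fun k => rect_subst g s (S n) k * a ^ k) (S n)).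
(* Since [g 0 j = 0], coefficients of G(x, T(x)) up to order n + 1 see T only up to order n, where
   [s] and [t] agree; the side [S n] makes [rect_subst] exact at these orders. *)
- right; apply sum_eq; intros k Hk; f_equal.
  rewrite rect_subst_eq;
    [| unfold s; destruct (Compare_dec.le_lt_dec 0 n); trivial | exact Hk].
  rewrite Hfix; apply PS_subst_agree; [apply wc_x0, Hwc|].
  intros m Hm; unfold s.
  destruct (Compare_dec.le_lt_dec m n); [reflexivity | lia].
- apply Rle_trans with (rect_sum (fun i j => g i j * a ^ i * S' ^ j) (S n)).
  + apply sum_f_R0_le_series; [|exact Hsub].
    intros k; apply Rmult_le_pos;
      [apply rect_subst_nonneg; assumption | apply pow_le, Ha].
  + apply Rle_trans with (rect_sum (fun i j => g i j * a ^ i * b ^ j) (S n)).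
    * apply rect_sum_le; intros i j; apply Rmult_le_compat_l.
      -- apply Rmult_le_pos; [apply Hg | apply pow_le, Ha].
      -- apply pow_incr; split; assumption.
    * apply rect_sum_le_double_series; [|exact HG].
      intros i j; repeat apply Rmult_le_pos; auto; apply pow_le; assumption.
Qed.

(* The limit is z because the tangent to G(a, .) at b is the diagonal:
   G(a, b) + G_y(a, b) (z - b) = b + (z - b). *)
Lemma characteristic_tangent_lim (g : nat -> nat -> R) (a b z : R) :
  (forall i j, 0 <= g i j) -> characteristic_point g a b ->
  is_lim_seq (rect_sum (fun i j =>
    g i j * a ^ i * (b ^ j + INR j * b ^ pred j * (z - b)))) z.
Proof.
intros Hg (Ha & Hb & HG & HD).
assert (HG' := is_lim_seq_rect_sum _ _
  (fun i j => Rmult_le_pos _ _ (Rmult_le_pos _ _ (Hg i j)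
     (pow_le a i (Rlt_le _ _ Ha))) (pow_le b j (Rlt_le _ _ Hb))) HG).
apply double_series_shift in HD; apply is_lim_seq_rect_sum in HD.
- apply (is_lim_seq_scal_l _ (z - b)) in HD.
  assert (H := is_lim_seq_plus' _ _ _ _ HG' HD).
  replace (b + (z - b) * 1) with z in H by ring.
  apply is_lim_seq_ext with (2 := H); intros M.
  rewrite <- rect_sum_scal, <- rect_sum_plus.
  apply sum_eq; intros i _; apply sum_eq; intros j _.
  destruct j as [|j]; [simpl; ring|].
  unfold partial_y, PS_derive; simpl pred; ring.
- intros i [|j]; [lra|]; unfold partial_y, PS_derive.
  repeat apply Rmult_le_pos; auto using pos_INR, pow_le, Rlt_le.
Qed.

(** The terms [u] dominate the tangent terms [v], whose square sums tend to z, while the square sums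
    of [u] stay at most z. There is no room for a positive gap at any single index. *)
Lemma term_le_tangent_of_subfixed (g : nat -> nat -> R) (a b x z : R) (i0 j0 : nat) :
  (forall i j, 0 <= g i j) -> characteristic_point g a b ->
  a <= x -> 0 <= z ->
  (forall M, rect_sum (fun i j => g i j * x ^ i * z ^ j) M <= z) ->
  g i0 j0 * x ^ i0 * z ^ j0
    <= g i0 j0 * a ^ i0 * (b ^ j0 + INR j0 * b ^ pred j0 * (z - b)).
Proof.
intros Hg Hc Hax Hz HM.
assert (Hlim := characteristic_tangent_lim g a b z Hg Hc).
destruct Hc as (Ha & Hb & _ & _).
set (v := fun i j => g i j * a ^ i * (b ^ j + INR j * b ^ pred j * (z - b))) in *.
set (u := fun i j => g i j * x ^ i * z ^ j) in *.
assert (Huv : forall i j, 0 <= u i j + -1 * v i j).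
{ intros i j; unfold u, v.
  pose proof (pow_tangent b z j (Rlt_le _ _ Hb) Hz) as Htan.
  pose proof (Rmult_le_pos _ _ (Hg i j) (pow_le a i (Rlt_le _ _ Ha))) as Hga.
  pose proof (Rmult_le_compat_l _ _ _ Hga Htan).
  assert (g i j * a ^ i * z ^ j <= g i j * x ^ i * z ^ j).
  { apply Rmult_le_compat_r; [apply pow_le, Hz|].
    apply Rmult_le_compat_l; [apply Hg|]; apply pow_incr; lra. }
  lra. }
change (u i0 j0 <= v i0 j0).
(* Every square containing (i0, j0) has its sum of [v] at most z minus the gap there; the limit
   inherits this bound. *)
assert (H : z <= z - (u i0 j0 + -1 * v i0 j0)); [|lra].
refine (is_lim_seq_le_loc _ _ z (z - (u i0 j0 + -1 * v i0 j0)) _ Hlim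
  (is_lim_seq_const _)).
exists (max i0 j0); intros M HM0.
pose proof (rect_sum_ge_term _ i0 j0 M Huv ltac:(lia) ltac:(lia)) as Hge.
rewrite (rect_sum_plus u (fun i j => -1 * v i j)), rect_sum_scal in Hge.
specialize (HM M); lra.
Qed.

(** * Locating the characteristic point *)

Lemma solution_at_characteristic (g : nat -> nat -> R) (t : nat -> R) (a b : R) :
  well_conditioned g -> standard_solution g t -> characteristic_point g a b ->
  is_pseries t a b.
Proof.
intros Hwc Hst Hc.
pose proof (wc_nonneg g Hwc) as Hg.
pose proof Hc as (Ha & Hb & HG & _); pose proof Hst as (_ & Ht & _).
assert (Hta : forall k, 0 <= t k * a ^ k).
{ intros k; apply Rmult_le_pos; [apply Ht | apply pow_le; lra]. }
pose proof (solution_partial_sum_le g t a b Hwc Hst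
  (Rlt_le _ _ Ha) (Rlt_le _ _ Hb) HG) as Hps.
destruct (ex_series_of_sum_f_R0_le _ b Hta Hps) as [l Hl].
(* The partial sum of order 0 gives l >= 0, as the tangent inequality requires. *)
pose proof (sum_f_R0_le_series _ _ 0 Hta Hl) as Hl0.
specialize (Hta 0%nat); simpl in Hl0, Hta.
apply is_pseries_R in Hl.
destruct (Req_dec l b) as [<-|Hne]; [exact Hl | exfalso].
(* Each [partial_y] shifts the column by one, so a nonzero coefficient of G_yy yields a positive
   g_ij with exponent at least 2 in y, where the tangent inequality is strict. *)
destruct (wc_dyy g Hwc) as (i & j & Hij).
assert (Hgij : 0 < g i (S (S j))).
{ destruct (Hg i (S (S j))) as [|E]; [assumption|].
  exfalso; apply Hij; unfold partial_y, PS_derive; rewrite <- E; ring. }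
pose proof (term_le_tangent_of_subfixed g a b a l i (S (S j)) Hg Hc
  (Rle_refl a) ltac:(lra)
  (fun M => rect_sum_at_solution_le g t a l M Hg Hst (Rlt_le _ _ Ha) Hl)) as H.
apply Rmult_le_reg_l in H;
  [|apply Rmult_lt_0_compat; [exact Hgij | apply pow_lt, Ha]].
pose proof (pow_tangent_strict b l j Hb ltac:(lra) Hne) as H'.
simpl pred in H; lra.
Qed.

Lemma solution_diverges_beyond (g : nat -> nat -> R) (t : nat -> R) (a b x : R) :
  well_conditioned g -> standard_solution g t -> characteristic_point g a b ->
  a < x -> ~ ex_pseries t x.
Proof.
intros Hwc Hst Hc Hax [l Hl].
pose proof (wc_nonneg g Hwc) as Hg.
pose proof Hc as (Ha & Hb & _ & _); pose proof Hst as (_ & Ht & _).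
(* Monotonicity of T gives l >= b > 0, hence the sign needed for the tangent inequality. *)
assert (Hbl : b <= l).
{ assert (Hs := solution_at_characteristic g t a b Hwc Hst Hc).
  apply is_pseries_R in Hs; pose proof Hl as Hl'; apply is_pseries_R in Hl'.
  refine (series_le_of_sum_f_R0_le _ _ _ _ Hs); intros n.
  apply Rle_trans with (sum_f_R0 (fun k => t k * x ^ k) n).
  - apply sum_Rle; intros k _; apply Rmult_le_compat_l; [apply Ht|].
    apply pow_incr; lra.
  - apply sum_f_R0_le_series; [|exact Hl'].
    intros k; apply Rmult_le_pos; [apply Ht | apply pow_le; lra]. }
(* The nonzero coefficient of G(x, 0) has positive exponent in x, so its monomial strictly increases
   from a to x. In column 0 the tangent is constant, and l drops out of the comparison. *)
destruct (wc_y0 g Hwc) as [[|i] Hi]; [apply Hi, wc_x0, Hwc|].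
pose proof (term_le_tangent_of_subfixed g a b x l (S i) 0 Hg Hc
  (Rlt_le _ _ Hax) ltac:(lra)
  (fun M => rect_sum_at_solution_le g t x l M Hg Hst ltac:(lra) Hl)) as H.
assert (Hgi : 0 < g (S i) 0%nat) by (specialize (Hg (S i) 0%nat); lra).
assert (Hpow : a ^ S i < x ^ S i).
{ apply Rle_lt_trans with (a * x ^ i).
  - apply Rmult_le_compat_l; [lra | apply pow_incr; lra].
  - apply Rmult_lt_compat_r; [apply pow_lt; lra | exact Hax]. }
pose proof (Rmult_lt_compat_l _ _ _ Hgi Hpow).
simpl INR in H; rewrite !pow_O in H; lra.
Qed.

Lemma characteristic_point_extreme (g : nat -> nat -> R) (t : nat -> R) (a b : R) :
  well_conditioned g -> standard_solution g t -> characteristic_point g a b ->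
  extreme_point t a b.
Proof.
intros Hwc Hst Hc.
pose proof (solution_at_characteristic g t a b Hwc Hst Hc) as Hs.
split; [|exact Hs].
pose proof Hc as (Ha & _).
apply Rbar_le_antisym; apply Rbar_not_lt_le; intros Hlt.
(* A radius above a, possibly infinite, leaves a point of convergence beyond a. *)
- assert (Hx : exists x, a < x /\ Rbar_lt x (CV_radius t)).
  { destruct (CV_radius t) as [r| |]; simpl in *.
    - exists ((a + r) / 2); lra.
    - exists (a + 1); split; [lra | exact I].
    - contradiction. }
  destruct Hx as (x & Hax & Hx).
  apply (solution_diverges_beyond g t a b x Hwc Hst Hc Hax).
  apply CV_radius_inside; rewrite Rabs_pos_eq by lra; exact Hx.
(* A radius below a would prevent the terms of T(a) from tending to 0. *)
- apply (CV_disk_outside t a); [rewrite Rabs_pos_eq by lra; exact Hlt|].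
  apply ex_series_lim_0; exists b; apply is_pseries_R, Hs.
Qed.

Theorem proposition15 (g : nat -> nat -> R) (hg : well_conditioned g) :
  (forall a b a' b' : R,
     characteristic_point g a b -> characteristic_point g a' b' ->
     a = a' /\ b = b') /\
  (forall (t : nat -> R), standard_solution g t ->
   forall a b : R, characteristic_point g a b -> extreme_point t a b).
Proof.
split.
- intros a b a' b' H H'.
  (* Both points are compared with the same T: its radius of convergence fixes the abscissa, and its
     value there fixes the ordinate. *)
  destruct (standard_solution_exists g hg) as [t Ht].
  destruct (characteristic_point_extreme g t a b hg Ht H) as [Hr Hs].
  destruct (characteristic_point_extreme g t a' b' hg Ht H') as [Hr' Hs'].
  rewrite Hr in Hr'; injection Hr' as <-.
  split; [reflexivity|].
  rewrite <- (is_pseries_unique _ _ _ Hs); exact (is_pseries_unique _ _ _ Hs').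
- intros t Ht a b H; exact (characteristic_point_extreme g t a b hg Ht H).
Qed.
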